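(* Let $\lambda>0$, let $\nu$ be a non-negative measure on $(0,\infty)$ with $\int_0^\infty (s\wedge 1)\,\nu(ds)<\infty$, let $f(x)=\int_0^\infty (1-e^{-xs})\,\nu(ds)$, and let $N^f(t)$, $t\ge 0$, be the generalized Poisson counting process associated with $(\lambda,\nu)$ (defined in the context). For $k\ge 1$ let $T_k^f=\inf\{t\ge 0: N^f(t)\ge k\}$. Then the probability density $$q_k^f(t)=\Pr\{T_k^f\in dt\}/dt,\qquad k\ge1,\ t>0,$$ solves the equation $$f(\lambda(I-B))\,q_k^f(t)=-\frac{d}{dt}q_k^f(t),$$ where $B$ is the shift operator in $k$ and $f(\lambda(I-B))$ is the operator defined in the context.
   Context: The generalized Poisson counting process $N^f(t)$, $t\ge0$, associated with $(\lambda,\nu)$ is a non-negative integer-valued process with $N^f(0)=0$ and non-decreasing right-continuous paths, with independent and stationary increments, such that, writing $N^f[t,t+dt)$ for the increment over $[t,t+dt)$, as $dt\downarrow 0$, $$\Pr\{N^f[t,t+dt)=k\}=\begin{cases} dt\,\dfrac{\lambda^k}{k!}\displaystyle\int_0^\infty e^{-\lambda s}s^k\,\nu(ds)+o(dt), & k\ge 1,\\[2mm] 1-dt\displaystyle\int_0^\infty(1-e^{-\lambda s})\,\nu(ds)+o(dt), & k=0.\end{cases}$$ For each $t>0$, $N^f(t)$ has the same law as $N(H^f(t))$, where $N$ is a homogeneous Poisson process of rate $\lambda$ and $H^f$ is an independent subordinator with $\mathbb{E}e^{-\mu H^f(t)}=e^{-tf(\mu)}$. The operator $B$ acts by $B^m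 q_k=q_{k-m}$, with $q_j(t)=0$ for $j\le 0$ and $t>0$; $I$ is the identity; and $$f(\lambda(I-B))\,q_k=\int_0^\infty\bigl(1-e^{-\lambda s(I-B)}\bigr)q_k\,\nu(ds),\qquad e^{-\lambda s(I-B)}q_k=e^{-\lambda s}\sum_{m=0}^\infty\frac{(\lambda sB)^m}{m!}\,q_k,$$ so that $f(\lambda(I-B))q_k=f(\lambda)q_k-\sum_{m=1}^{k-1}\Bigl(\int_0^\infty e^{-\lambda s}\frac{(\lambda s)^m}{m!}\,\nu(ds)\Bigr)q_{k-m}$. *)

(* Defs.v *)
From HB Require Import structures.
From mathcomp Require Import all_boot all_order all_algebra.
From mathcomp Require Import all_classical all_reals all_analysis.
Import Order.TTheory GRing.Theory Num.Theory.
Import numFieldNormedType.Exports.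

Set Implicit Arguments.
Unset Strict Implicit.
Unset Printing Implicit Defensive.

Local Open Scope classical_set_scope.
Local Open Scope ring_scope.

(* A measure on (0,+oo) is represented by a Borel measure nu on R, of which only
   the restriction to `]0, +oo[ is ever used. *)
Definition levy_condition (R : realType)
    (nu : {measure set (measurableTypeR R) -> \bar R}) : Prop :=
  (\int[nu]_(s in `]0%R, +oo[) (Num.min s 1)%:E < +oo)%E.

Definition bernstein (R : realType)
    (nu : {measure set (measurableTypeR R) -> \bar R}) (x : R) : R :=
  \int[nu]_(s in `]0, +oo[) (1 - expR (- (x * s))).

Section Process.
Context d (T : measurableType d) (R : realType) (P : probability T R).
Implicit Types (N : R -> {RV P >-> nat}).

Definition mutually_independent (n : nat) (X : 'I_n -> T -> nat) : Prop :=
  forall B : 'I_n -> set nat,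
    P (\bigcap_(i in [set: 'I_n]) (X i @^-1` B i)) =
    (\prod_(i < n) P (X i @^-1` B i))%E.

(* N (s + h) - N s, in truncated subtraction: it is only applied to processes
   with non-decreasing paths. *)
Definition increment N (s t : R) (w : T) : nat := (N t w - N s w)%N.

Definition independent_increments N : Prop :=
  forall (n : nat) (t : nat -> R), 0 <= t 0%N -> {homo t : i j / (i <= j)%N >-> i <= j} ->
    mutually_independent (fun i : 'I_n => increment N (t i) (t i.+1)).

Definition stationary_increments N : Prop :=
  forall s t h : R, 0 <= s -> 0 <= t -> 0 <= h -> forall B : set nat,
    P (increment N s (s + h) @^-1` B) = P (increment N t (t + h) @^-1` B).

Definition increment_prob N (t h : R) (k : nat) : R :=
  fine (P [set w | increment N t (t + h) w = k]).

Record generalized_poisson_process (lambda : R)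
    (nu : {measure set (measurableTypeR R) -> \bar R}) N : Prop := {
  gpp_start : forall w, N 0 w = 0%N ;
  gpp_mono : forall w (s t : R), 0 <= s -> s <= t -> (N s w <= N t w)%N ;
  gpp_rcont : forall w (t : R), 0 <= t -> N s w @[s --> t^'+] --> N t w ;
  gpp_indep : independent_increments N ;
  gpp_stat : stationary_increments N ;
  gpp_jump : forall (t : R) (k : nat), 0 <= t -> (1 <= k)%N ->
    (fun h : R => increment_prob N t h k
       - h * (lambda ^+ k / k`!%:R *
              \int[nu]_(s in `]0, +oo[) (expR (- (lambda * s)) * s ^+ k)))
    =o_ (0^'+) (fun h : R => h) ;
  gpp_stay : forall t : R, 0 <= t ->
    (fun h : R => increment_prob N t h 0 - (1 - h * bernstein nu lambda))
    =o_ (0^'+) (fun h : R => h) }.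

(* Takes the value +oo when the level k is never reached. *)
Definition hitting_time N (k : nat) (w : T) : \bar R :=
  ereal_inf [set t%:E | t in [set t : R | 0 <= t /\ (k <= N t w)%N]].

Definition hitting_cdf N (k : nat) (t : R) : R :=
  fine (P [set w | (hitting_time N k w <= t%:E)%E]).

(* q_k(t) = Pr{T_k \in dt}/dt for k >= 1, extended by q_j = 0 for j <= 0 so that
   the shift operator acts on it. *)
Definition hitting_density N (k : int) (t : R) : R :=
  if k is Posz n.+1 then derive1 (hitting_cdf N n.+1) t else 0.

(* q is a density on (0,+oo) of the [0,+oo]-valued variable X, which may have
   an atom at +oo but none on [0,+oo). *)
Definition is_density (X : T -> \bar R) (q : R -> R) : Prop :=
  [/\ forall t, 0 < t -> 0 <= q t,
      measurable_fun (`]0, +oo[ : set R) q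
    & forall A : set R, measurable A ->
        P [set w | exists2 t, A t & X w = t%:E] =
        (\int[lebesgue_measure]_(t in A `&` `]0%R, +oo[) (q t)%:E)%E].

End Process.

Section Operators.
Context (R : realType).
Implicit Types (q : int -> R -> R).

Definition shift_op q : int -> R -> R := fun k => q (k - 1).

(* e^{- lambda s (I - B)} *)
Definition exp_shift_op (lambda s : R) q : int -> R -> R := fun k t =>
  expR (- (lambda * s)) *
  limn (series (fun m => (lambda * s) ^+ m / m`!%:R * iter m shift_op q k t)).

(* f(lambda (I - B)), f being the Bernstein function of nu *)
Definition bernstein_shift_op (lambda : R)
    (nu : {measure set (measurableTypeR R) -> \bar R}) q : int -> R -> R :=
  fun k t => \int[nu]_(s in `]0, +oo[) (q k t - exp_shift_op lambda s q k t).

End Operators.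

(* Main.v *)
From HB Require Import structures.
Require Import Defs.
From mathcomp Require Import all_boot all_order all_algebra.
From mathcomp Require Import all_classical all_reals all_analysis.
From mathcomp Require Import measurable_realfun zify ring lra.
Import Order.TTheory GRing.Theory Num.Theory.
Import numFieldNormedType.Exports.

(** The process has reached level k at time t exactly when N(t) >= k, so the
    tail of the hitting time is u_k(t) = Pr{N(t) < k} (hitting_time_leP, which
    needs right-continuity of the paths). If m is the increment over [t, t+h],
    then N(t+h) < k means N(t) < k - m; hence, by independence and stationarity
    of the increments,

      u_k(t+h) = sum_(m < k) p_m(h) u_(k-m)(t),   p_m(h) = Pr{N(h) = m}

    (survival_convolution). This is a finite triangular system, because jumps of
    size k or more always reach the level. As h decreases to 0,
    p_m(h) = [m = 0] + h c_m + o(h), where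

      c_m = int_0^oo (e^(-lambda s) (lambda s)^m / m! - [m = 0]) nu(ds)

    (increment_prob_rate). The error in h is uniform in t since 0 <= u_k <= 1,
    and a right derivative with uniform error and continuous value is a
    two-sided derivative; so u_k' = sum_(m < k) c_m u_(k-m) on (0, oo)
    (convolution_is_derive).

    Therefore q_k = - u_k' is itself a finite linear combination of the u_j. It
    is continuous up to 0, and the fundamental theorem of calculus makes it the
    density of T_k (is_density_of_cdf). It is also differentiable, and since the
    coefficients c_m are constant, differentiating once more shows that the q_k
    satisfy the same system q_k' = sum_(m < k) c_m q_(k-m).

    On sequences vanishing at the indices k <= 0, the exponential series of the
    shift is a finite sum, and integrating it term by term identifies
    f(lambda (I - B)) q_k with - sum_(m < k) c_m q_(k-m) (bernstein_shift_opE),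
    which is therefore - q_k'. *)

Set Implicit Arguments.
Unset Strict Implicit.
Unset Printing Implicit Defensive.

Local Open Scope classical_set_scope.
Local Open Scope ring_scope.

(** * Derivatives from uniform one-sided increments *)

Section Increments.
Context {R : realType}.
Implicit Types (u G : R -> R).

Lemma near_right0_exists (P : R -> Prop) :
  (\forall h \near (0:R)^'+, P h) ->
  exists2 d : R, 0 < d & forall h, 0 < h -> h < d -> P h.
Proof.
move=> /nbhs_right0P[d /= d0 dP]; exists d => // h h0 hd.
by have := dP h; rewrite /ball/= sub0r normrN gtr0_norm// add0r; exact.
Qed.

Lemma near_gt0_eq (f g : R -> R) (t : R) : 0 < t ->
  (forall x, 0 < x -> f x = g x) -> \forall x \near t, f x = g x.
Proof.
by move=> t0 fg; near=> x; apply: fg; near: x; exact: lt_nbhsr.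
Unshelve. all: by end_near. Qed.

(** Uniformity in the base point turns control to the right into control to the
    left: the increment from t - h to t is a right increment based at t - h. *)
Lemma uniform_right_continuous_at u (t : R) :
  (forall eps, 0 < eps -> \forall h \near 0^'+, forall s, 0 <= s ->
     `|u (s + h) - u s| <= eps) ->
  0 < t -> {for t, continuous u}.
Proof.
move=> ru t0; apply/cvgrPdist_le => /= eps eps0.
have /near_right0_exists[d d0 dP] := ru _ eps0.
near=> x; have [->|xt] := eqVneq x t; first by rewrite subrr normr0 ltW.
have : `|t - x| < Num.min d t.
  by near: x; apply: cvgr_dist_lt => //; rewrite lt_min d0.
rewrite lt_min => /andP[xd]; rewrite ltr_distlC => /andP[x0 _].
rewrite subrr in x0.
move: xt; rewrite neq_lt => /orP[] xt.
  rewrite gtr0_norm ?subr_gt0// in xd.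
  by rewrite -[X in u X - _](subrKC x t); apply: dP; rewrite ?subr_gt0// ltW.
rewrite distrC gtr0_norm ?subr_gt0// in xd.
rewrite distrC -[X in u X - _](subrKC t x).
by apply: dP; rewrite ?subr_gt0// ltW.
Unshelve. all: by end_near. Qed.

(** The difference quotient over [t - h, t] is close to G (t - h), by uniformity
    of the error in the base point, and G (t - h) is close to G t. *)
Lemma uniform_right_derivative_is_derive u G (t : R) :
  (forall eps, 0 < eps -> \forall h \near 0^'+, forall s, 0 <= s ->
     `|u (s + h) - u s - h * G s| <= eps * h) ->
  {for t, continuous G} -> 0 < t ->
  is_derive t (1 : R) u (G t).
Proof.
move=> ru cG t0.
suff cu : (fun h => h^-1 *: (u (h *: 1 + t) - u t)) @ 0^' --> G t.
  apply: DeriveDef; first by apply/cvg_ex; exists (G t).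
  exact/cvg_lim.
apply/cvgrPdist_le => /= eps eps0.
have e20 : 0 < eps / 2 by rewrite divr_gt0.
have /near_right0_exists[d d0 dP] := ru _ e20.
have /cvgrPdist_le/(_ _ e20)/=[d' /= d'0 d'P] := cG.
(* s is the left endpoint of the interval between t and t + h: t or t + h,
   according to the sign of the increment. *)
have slope s h : 0 <= s -> 0 < h -> h < d -> `|G t - G s| <= eps / 2 ->
    `|G t - h^-1 * (u (s + h) - u s)| <= eps.
  move=> s0 h0 hd Gs.
  have -> : G t - h^-1 * (u (s + h) - u s) =
      (G t - G s) - h^-1 * (u (s + h) - u s - h * G s).
    by field; rewrite gt_eqF.
  rewrite (le_trans (ler_normB _ _))// [leRHS](splitr eps) lerD//.
  by rewrite normrM gtr0_norm ?invr_gt0// mulrC ler_pdivrMr// dP.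
have G0 : `|G t - G t| <= eps / 2 by rewrite subrr normr0 ltW.
near=> h.
have h0 : h != 0 by near: h; exact: nbhs_dnbhs_neq.
have : `|h| < Num.min (Num.min d d') t.
  by near: h; apply: dnbhs0_lt; rewrite !lt_min d0 d'0.
rewrite !lt_min scaler1 -/(h^-1 * _) => /andP[/andP[hd hd'] ht].
move: h0; rewrite neq_lt => /orP[] h0.
  rewrite ltr0_norm// in hd hd' ht.
  have -> : h^-1 *: (u (h + t) - u t) =
      (- h)^-1 * (u ((h + t) + - h) - u (h + t)).
    rewrite (_ : h + t + - h = t); last by ring.
    by rewrite invrN mulNr -mulrN opprB.
  apply: slope => //; [lra|lra|].
  by apply: d'P => /=; rewrite ltr_distlC; apply/andP; split; lra.
rewrite gtr0_norm// in hd hd' ht.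
by rewrite (addrC h); apply: slope => //; exact: ltW.
Unshelve. all: by end_near. Qed.

End Increments.

(** * Convolution systems with infinitesimal rates *)

Section ConvolutionSystem.
Context {R : realType}.
Variables (u p : nat -> R -> R) (c : nat -> R).
Hypothesis u01 : forall k (t : R), 0 <= t -> 0 <= u k t <= 1.
Hypothesis u_convolution : forall k (t h : R), 0 <= t -> 0 <= h ->
  u k (t + h) = \sum_(m < k) p m h * u (k - m)%N t.
Hypothesis p_rate : forall m (eps : R), 0 < eps -> \forall h \near 0^'+,
  `|p m h - (m == 0%N)%:R - h * c m| <= eps * h.

Definition convolution_rate k t := \sum_(m < k) c m * u (k - m)%N t.

(** Writing u k t as the same convolution against the unit mass at 0 leaves only
    the error terms of p. For k = 0 both sides vanish: u 0 is an empty sum. *)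
Lemma convolution_defect k (t h : R) : 0 <= t -> 0 <= h ->
  u k (t + h) - u k t - h * convolution_rate k t =
  \sum_(m < k) (p m h - (m == 0%N :> nat)%:R - h * c m) * u (k - m)%N t.
Proof.
move=> t0 h0; rewrite u_convolution//.
have -> : u k t = \sum_(m < k) (m == 0%N :> nat)%:R * u (k - m)%N t.
  case: k => [|k].
    by rewrite big_ord0 -[t]addr0 u_convolution// big_ord0.
  rewrite big_ord_recl/= subn0 mul1r big1 ?addr0// => i _.
  by rewrite mul0r.
rewrite mulr_sumr -!sumrB; apply: eq_bigr => i _.
by rewrite !mulrBl mulrA.
Qed.

Lemma convolution_right_derivative k (eps : R) : 0 < eps ->
  \forall h \near 0^'+, forall t, 0 <= t ->
    `|u k (t + h) - u k t - h * convolution_rate k t| <= eps * h.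
Proof.
(* Each of the k terms gets an equal share of eps; k.+1 avoids dividing by 0. *)
move=> eps0; pose e := eps / k.+1%:R.
have e0 : 0 < e by rewrite divr_gt0.
have /filter_forall : forall m : 'I_k, \forall h \near 0^'+,
  `|p m h - (m == 0%N :> nat)%:R - h * c m| <= e * h.
  by move=> m; exact: p_rate.
move=> near_p; near=> h => t t0.
have h0 : 0 < h by near: h; exact: nbhs_right_gt.
rewrite convolution_defect ?(ltW h0)// (le_trans (ler_norm_sum _ _ _))//.
have -> : eps * h = k.+1%:R * (e * h).
  by rewrite mulrA mulrCA divff// mulr1.
rewrite -natr1 mulrDl mul1r ler_wpDr ?(ltW (mulr_gt0 e0 h0))//.
rewrite mulr_natl -[X in _ *+ X]card_ord -sumr_const ler_sum// => i _.
have /andP[ui0 ui1] := u01 (k - i)%N t0.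
rewrite normrM (ger0_norm ui0) (le_trans (ler_piMr _ ui1))//.
by move: (i); near: h.
Unshelve. all: by end_near. Qed.

Lemma convolution_right_continuous k (eps : R) : 0 < eps ->
  \forall h \near 0^'+, forall t, 0 <= t -> `|u k (t + h) - u k t| <= eps.
Proof.
(* The rate is bounded by the sum of the `|c m|; the 1 pays for the error h of
   the linear approximation. *)
move=> eps0; pose C := 1 + \sum_(m < k) `|c m|.
have C0 : 0 < C by rewrite ltr_pwDl// sumr_ge0.
near=> h => t t0.
have h0 : 0 < h by near: h; exact: nbhs_right_gt.
have hC : h * C <= eps.
  rewrite -ler_pdivlMr//; near: h; apply: nbhs_right_le.
  by rewrite divr_gt0.
apply: le_trans hC; rewrite -[X in `|X|](subrK (h * convolution_rate k t)).
rewrite (le_trans (ler_normD _ _))// /C mulrDr mulr1 lerD//.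
  rewrite -[leRHS]mul1r; move: t t0; near: h.
  exact: convolution_right_derivative.
rewrite normrM gtr0_norm// ler_wpM2l ?(ltW h0)//.
rewrite (le_trans (ler_norm_sum _ _ _))// ler_sum// => i _.
have /andP[ui0 ui1] := u01 (k - i)%N t0.
by rewrite normrM (ger0_norm ui0) ler_piMr.
Unshelve. all: by end_near. Qed.

Lemma convolution_cvg_right0 k : u k t @[t --> 0^'+] --> u k 0.
Proof.
apply/cvgrPdist_le => /= eps eps0; near=> h.
rewrite distrC -[h in u k h]add0r.
have : forall t, 0 <= t -> `|u k (t + h) - u k t| <= eps.
  by near: h; exact: convolution_right_continuous.
exact.
Unshelve. all: by end_near. Qed.

Lemma convolution_continuous k (t : R) : 0 < t -> {for t, continuous (u k)}.
Proof.
by apply: uniform_right_continuous_at; exact: convolution_right_continuous.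
Qed.

Lemma convolution_rate_cvg k (F : set_system R) (t : R) : Filter F ->
  (forall j, u j x @[x --> F] --> u j t) ->
  convolution_rate k x @[x --> F] --> convolution_rate k t.
Proof.
move=> FF uF; rewrite /convolution_rate.
apply: cvg_big => [|i _]; first exact: add_continuous.
by apply: cvgM; [exact: cvg_cst|exact: uF].
Qed.

Lemma convolution_is_derive k (t : R) : 0 < t ->
  is_derive t (1 : R) (u k) (convolution_rate k t).
Proof.
move=> t0; apply: uniform_right_derivative_is_derive => //.
  exact: convolution_right_derivative.
by apply: convolution_rate_cvg => j; exact: convolution_continuous.
Qed.

End ConvolutionSystem.

(** * Jump rates and the operator f(lambda (I - B)) *)

Section RintegralSum.
Context d (T : measurableType d) (R : realType) (mu : {measure set T -> \bar R}).

Lemma Rintegral_sum (D : set T) (n : nat) (f : 'I_n -> T -> R) :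
  measurable D -> (forall i, mu.-integrable D (EFin \o f i)) ->
  \int[mu]_(x in D) (\sum_(i < n) f i x) =
  \sum_(i < n) \int[mu]_(x in D) f i x.
Proof.
move=> mD intf; elim: n f intf => [|n IH] f intf.
  under eq_Rintegral do rewrite big_ord0.
  by rewrite big_ord0 Rintegral_cst// mul0r.
under eq_Rintegral do rewrite big_ord_recr.
rewrite big_ord_recr RintegralD//= ?IH//.
under [X in integrable _ _ X]eq_fun do rewrite /= -sumEFin.
by apply: integrable_sum => // i _; exact: intf.
Qed.

End RintegralSum.

Section Operator.
Context (R : realType) (lambda : R).
Variable nu : {measure set (measurableTypeR R) -> \bar R}.
Implicit Types (q : int -> R -> R).
Hypothesis lambda_gt0 : 0 < lambda.
Hypothesis nu_levy : levy_condition nu.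

(** The Poisson probability of m arrivals in operational time s, compensated at
    m = 0. The compensation makes the weight integrable for every m although nu
    may have infinite mass near 0, and it lets a single sequence of rates hold
    both the jump intensities and the coefficient - f(lambda) at m = 0. *)
Definition jump_weight (m : nat) (s : R) : R :=
  expR (- (lambda * s)) * ((lambda * s) ^+ m / m`!%:R) - (m == 0%N)%:R.

Definition jump_rate (m : nat) : R :=
  \int[nu]_(s in `]0, +oo[) jump_weight m s.

Lemma measurable_jump_weight m (D : set R) : measurable_fun D (jump_weight m).
Proof.
have ml : measurable_fun D (fun s => lambda * s) by exact: measurable_funM.
apply: measurable_funB => //; apply: measurable_funM.
  by apply: measurableT_comp => //; exact: measurable_funN.
by apply: measurable_funM => //; exact: measurable_funX.
Qed.

(** In absolute value every weight is at most 1 - e^(- lambda s), the probability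
    of at least one arrival: for m > 0, because expR x >= 1 + x ^+ m / m`!. *)
Lemma jump_weight_le m (s : R) : 0 < s ->
  `|jump_weight m s| <= Num.max lambda 1 * Num.min s 1.
Proof.
move=> s0; have ls0 : 0 < lambda * s by rewrite mulr_gt0.
have max0 : 0 < Num.max lambda 1 by rewrite lt_max ltr01 orbT.
have E0 : 0 < expR (- (lambda * s)) by exact: expR_gt0.
apply: (@le_trans _ _ (1 - expR (- (lambda * s)))); last first.
  have [s1|s1] := leP s 1.
    rewrite (@le_trans _ _ (lambda * s))//.
      by have := expR_ge1Dx (- (lambda * s)); lra.
    by rewrite ler_pM2r// le_max lexx.
  by rewrite mulr1 le_max; apply/orP; right; lra.
rewrite /jump_weight; case: m => [|m].
  rewrite expr0 fact0 divr1 mulr1 distrC ger0_norm// subr_ge0.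
  by rewrite -expR0 ler_expR oppr_le0 ltW.
rewrite subr0 ger0_norm ?mulr_ge0 ?exprn_ge0 ?(ltW ls0) ?(ltW E0)//.
rewrite lerBrDr -[leRHS](expRxMexpNx_1 (lambda * s)) addrC.
rewrite -[X in X + _]mulr1 -mulrDr mulrC ler_pM2r//.
exact: expR_ge1Dxn (ltW ls0).
Qed.

Lemma integrable_jump_weight m :
  nu.-integrable `]0, +oo[ (EFin \o jump_weight m).
Proof.
have int_min : nu.-integrable `]0, +oo[ (fun s : R => (Num.min s 1)%:E).
  apply/integrableP; split.
    by apply/measurable_EFinP; exact: measurable_minr.
  move: nu_levy; rewrite /levy_condition; congr (_ < _)%E.
  apply: eq_integral => s; rewrite inE/= in_itv/= andbT => s0.
  by rewrite ger0_norm// le_min ler01 andbT ltW.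
apply: le_integrable (integrableZl _ (Num.max lambda 1) int_min) => //.
  by apply/measurable_EFinP; exact: measurable_jump_weight.
move=> s /=; rewrite in_itv/= andbT => s0; rewrite lee_fin.
exact: le_trans (jump_weight_le m s0) (ler_norm _).
Qed.

Lemma jump_rate0 : jump_rate 0 = - bernstein nu lambda.
Proof.
suff -> : bernstein nu lambda = -1 * jump_rate 0 by rewrite mulN1r opprK.
rewrite -RintegralZl//; last exact: integrable_jump_weight.
apply: eq_Rintegral => s _.
by rewrite /jump_weight expr0 fact0 divr1 mulr1 mulN1r opprB.
Qed.

Lemma jump_rateS m : (0 < m)%N ->
  jump_rate m = lambda ^+ m / m`!%:R *
    \int[nu]_(s in `]0, +oo[) (expR (- (lambda * s)) * s ^+ m).
Proof.
move=> m0; set a := lambda ^+ m / m`!%:R.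
have a0 : a != 0.
  by rewrite mulf_neq0 ?expf_neq0 ?invr_eq0 ?pnatr_eq0 -?lt0n ?fact_gt0 ?gt_eqF.
have weightE s : jump_weight m s = a * (expR (- (lambda * s)) * s ^+ m).
  rewrite /jump_weight eqn0Ngt m0 subr0 exprMn /a; ring.
suff -> : \int[nu]_(s in `]0, +oo[) (expR (- (lambda * s)) * s ^+ m) =
    a^-1 * jump_rate m by rewrite mulVKf.
rewrite -RintegralZl//; last exact: integrable_jump_weight.
by apply: eq_Rintegral => s _; rewrite weightE mulKf.
Qed.

Lemma iter_shift_op q m k t : iter m (@shift_op R) q k t = q (k - m%:Z) t.
Proof.
elim: m k => [|m IH] k; first by rewrite subr0.
by rewrite /= /shift_op IH -addn1 PoszD opprD addrA addrAC.
Qed.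

(** The terms m >= k of the exponential series vanish, so the partial sums are
    constant from rank k on. *)
Lemma exp_shift_opE q (k : nat) (s t : R) :
  (forall j : int, (j <= 0)%R -> q j t = 0) ->
  exp_shift_op lambda s q k t =
  \sum_(m < k) expR (- (lambda * s)) * ((lambda * s) ^+ m / m`!%:R) *
    q (k - m)%N t.
Proof.
move=> q0; rewrite /exp_shift_op.
under eq_bigr => m _ do rewrite -mulrA.
rewrite -mulr_sumr; congr (_ * _).
apply: (@lim_near_cst _ _ _ _ _ (\sum_(m < k) _)) => //.
near=> n; rewrite /series/= -(big_mkord xpredT (fun m =>
  (lambda * s) ^+ m / m`!%:R * q (k - m)%N t)).
have kn : (k <= n)%N by near: n; exact: nbhs_infty_ge.
rewrite (big_cat_nat _ kn)//= [X in _ + X]big_nat_cond [X in _ + X]big1 ?addr0.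
  apply: eq_big_nat => m /andP[_ mk].
  by rewrite iter_shift_op subzn// ltnW.
move=> m; rewrite andbT => /andP[km _].
by rewrite iter_shift_op q0 ?mulr0// subr_le0 lez_nat.
Unshelve. all: by end_near. Qed.

Lemma bernstein_shift_opE q (k : nat) (t : R) : (0 < k)%N ->
  (forall j : int, (j <= 0)%R -> q j t = 0) ->
  bernstein_shift_op lambda nu q k t =
  - \sum_(m < k) jump_rate m * q (k - m)%N t.
Proof.
move=> k0 q0; rewrite /bernstein_shift_op.
transitivity (\int[nu]_(s in `]0, +oo[)
    (\sum_(m < k) (- q (k - m)%N t) * jump_weight m s)).
  apply: eq_Rintegral => s _; rewrite exp_shift_opE//.
  have -> : q k t = \sum_(m < k) (m == 0%N :> nat)%:R * q (k - m)%N t.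
    case: k k0 => // k _; rewrite big_ord_recl/= subn0 mul1r.
    by rewrite big1 ?addr0// => i _; rewrite mul0r.
  rewrite -sumrB; apply: eq_bigr => m _; rewrite /jump_weight; ring.
have int_term (m : 'I_k) : nu.-integrable `]0, +oo[
    (EFin \o (fun s => (- q (k - m)%N t) * jump_weight m s)).
  exact: integrableZl (integrable_jump_weight m).
rewrite Rintegral_sum// -sumrN; apply: eq_bigr => m _.
by rewrite RintegralZl ?mulNr ?(mulrC (q _ _))//; exact: integrable_jump_weight.
Qed.

End Operator.

(** * Tail probabilities of the counting process *)

Section Process.
Context d (T : measurableType d) (R : realType) (P : probability T R).
Context (lambda : R) (nu : {measure set (measurableTypeR R) -> \bar R}).
Variable N : R -> {RV P >-> nat}.
Hypothesis N_gpp : generalized_poisson_process lambda nu N.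

Lemma measurable_preimage_count (t : R) (B : set nat) :
  measurable (N t @^-1` B).
Proof. by rewrite -[X in measurable X]setTI; exact: measurable_funPT. Qed.

Lemma measurable_preimage_increment (s t : R) (B : set nat) :
  measurable (increment N s t @^-1` B).
Proof.
rewrite -[X in measurable X]setTI.
have : measurable_fun setT (increment N s t) by exact: measurable_fun_subn.
exact.
Qed.

(** The infimum is attained: by right-continuity an integer-valued path is
    constant on some [t, t + e), so if it is below level k at t, the level is not
    reached before t + e. *)
Lemma hitting_time_leP (k : nat) (w : T) (t : R) :
  (hitting_time N k w <= t%:E)%E <-> 0 <= t /\ (k <= N t w)%N.
Proof.
split=> [Tt|[t0 kt]]; last by apply: ereal_inf_lbound; exists t.
have t0 : 0 <= t.
  rewrite -lee_fin (le_trans _ Tt)//.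
  apply: le_ereal_inf_tmp => _ [s [s0 _] <-].
  by rewrite lee_fin.
split=> //; rewrite leqNgt; apply/negP => tk.
have : \forall s \near t^'+, N s w = N t w.
  have /= Nt := gpp_rcont N_gpp (w := w) t0 (discrete_set1 (N t w)).
  exact: Nt.
move=> /nbhs_right0P/near_right0_exists[e e0 Ne].
have /ereal_inf_lt[_ [s [s0 ks] <-]] : (hitting_time N k w < (t + e)%:E)%E.
  by rewrite (le_lt_trans Tt)// lte_fin ltrDl.
rewrite lte_fin => st; have [ts|ts] := leP s t.
  by move: tk; rewrite ltnNge (leq_trans ks)//; exact: (gpp_mono N_gpp) s0 ts.
move: tk; rewrite ltnNge -(Ne (s - t)) ?subr_gt0//; last by rewrite ltrBlDl.
by rewrite subrKC ks.
Qed.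

Definition survival (k : nat) (t : R) : R := fine (P [set w | (N t w < k)%N]).

Lemma survival_ge0_le1 k t : 0 <= survival k t <= 1.
Proof.
rewrite /survival fine_ge0//= -lee_fin fineK ?probability_le1//.
  exact: (measurable_preimage_count t [set j | (j < k)%N]).
apply: fin_num_measure.
exact: (measurable_preimage_count t [set j | (j < k)%N]).
Qed.

Lemma independent_increment_prob (t h : R) (A B : set nat) : 0 <= t -> 0 <= h ->
  P ((N t @^-1` A) `&` (increment N t (t + h) @^-1` B)) =
  (P (N t @^-1` A) * P (increment N t (t + h) @^-1` B))%E.
Proof.
(* The partition 0 <= t <= t + h, continued by t + h. *)
move=> t0 h0; pose r (i : nat) : R := nth (t + h) [:: 0; t] i.
have r_homo : {homo r : i j / (i <= j)%N >-> i <= j}.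
  move=> [|[|i]] [|[|j]]//= _; rewrite /r/= ?nth_nil ?addr_ge0//.
    by rewrite lerDl.
have incr0 : increment N 0 t = N t.
  by apply/funext => w; rewrite /increment (gpp_start N_gpp) subn0.
have := gpp_indep N_gpp (n := 2) (t := r) (lexx 0) r_homo.
move=> /(_ (fun i : 'I_2 => if i == 0 then A else B)).
rewrite !big_ord_recl big_ord0 mule1/= -incr0 => <-.
congr (P _); apply/seteqP; split=> w /=.
  by move=> [wA wB] [[|[|//]] i2] _.
by move=> wAB; split; [exact: (wAB ord0)|exact: (wAB (lift ord0 ord0))].
Qed.

(** The events are split according to the increment m over [t, t + h]; a value
    m >= k already carries the path to level k. *)
Lemma survival_convolution k (t h : R) : 0 <= t -> 0 <= h ->
  survival k (t + h) =
  \sum_(m < k) increment_prob N 0 h m * survival (k - m)%N t.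
Proof.
move=> t0 h0.
pose F m := (N t @^-1` [set j | (j < k - m)%N]) `&`
  (increment N t (t + h) @^-1` [set m]).
have mF m : measurable (F m).
  by apply: measurableI; [exact: measurable_preimage_count|
    exact: measurable_preimage_increment].
have tF : trivIset setT F.
  by move=> i j _ _ [w [[_ /= <-] [_ /= <-]]].
have FE : [set w | (N (t + h) w < k)%N] = \big[setU/set0]_(m < k) F m.
  rewrite -bigcup_mkord; apply/seteqP; split=> w /=.
    have le_N : (N t w <= N (t + h) w)%N by apply: (gpp_mono N_gpp); lra.
    move=> Nk; exists (increment N t (t + h) w) => /=.
      exact: leq_ltn_trans (leq_subr _ _) Nk.
    by split=> //=; rewrite ltn_subRL /increment subnK.
  by move=> [m /= mk [/=]]; rewrite /increment; lia.
have mul_F m : P (F m) = ((increment_prob N 0 h m) * survival (k - m)%N t)%:E.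
  rewrite independent_increment_prob// muleC EFinM.
  have -> : P (increment N t (t + h) @^-1` [set m]) =
            P (increment N 0 (0 + h) @^-1` [set m]).
    exact: (gpp_stat N_gpp).
  rewrite /increment_prob /survival !fineK//; apply: fin_num_measure.
    exact: (measurable_preimage_count t [set j | (j < k - m)%N]).
  exact: (measurable_preimage_increment 0 (0 + h) [set m]).
rewrite [LHS]/survival FE measure_bigsetU//.
by rewrite (eq_bigr _ (fun (m : 'I_k) _ => mul_F m)) sumEFin.
Qed.

Lemma hitting_cdfE k (t : R) : 0 <= t -> hitting_cdf N k t = 1 - survival k t.
Proof.
move=> t0; rewrite /hitting_cdf /survival.
have -> : [set w | (hitting_time N k w <= t%:E)%E] = ~` [set w | (N t w < k)%N].
  apply/seteqP; split=> w /=.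
    by move=> /hitting_time_leP[_]; rewrite leqNgt => /negP.
  by move=> /negP; rewrite -leqNgt => kt; apply/hitting_time_leP.
have mS : measurable [set w | (N t w < k)%N].
  exact: (measurable_preimage_count t [set j | (j < k)%N]).
by rewrite probability_setC// fineB// fin_num_measure.
Qed.

Lemma increment_prob_rate (m : nat) (eps : R) : 0 < lambda ->
  levy_condition nu -> 0 < eps ->
  \forall h \near 0^'+,
  `|increment_prob N 0 h m - (m == 0%N)%:R - h * jump_rate lambda nu m| <=
  eps * h.
Proof.
move=> lambda0 levy eps0; have [->|m0] := posnP m.
  have /eqoP/(_ _ eps0) := gpp_stay N_gpp (lexx 0).
  move=> near_h; near=> h.
  have h0 : 0 < h by near: h; exact: nbhs_right_gt.
  have : `|increment_prob N 0 h 0 - (1 - h * bernstein nu lambda)| <=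
      eps * `|h| by near: h.
  rewrite (gtr0_norm h0) (jump_rate0 lambda0 levy).
  by rewrite mulrN opprK opprB addrA addrAC.
have /eqoP/(_ _ eps0) := gpp_jump N_gpp (lexx 0) m0.
rewrite -(jump_rateS lambda0 levy m0) => near_h; near=> h.
have h0 : 0 < h by near: h; exact: nbhs_right_gt.
have : `|increment_prob N 0 h m - h * jump_rate lambda nu m| <= eps * `|h|.
  by near: h.
by rewrite (gtr0_norm h0) subr0.
Unshelve. all: by end_near. Qed.

Lemma hitting_time_ge0 k w : (0 <= hitting_time N k w)%E.
Proof. by apply: le_ereal_inf_tmp => _ [s [s0 _] <-]; rewrite lee_fin. Qed.

Lemma measurable_hitting_time_le k (t : R) :
  measurable [set w | (hitting_time N k w <= t%:E)%E].
Proof.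
have [t0|t0] := leP 0 t.
  rewrite (_ : [set w | _] = N t @^-1` [set j | (k <= j)%N]).
    exact: measurable_preimage_count.
  apply/seteqP; split=> w /=; first by move=> /hitting_time_leP[].
  by move=> kt; apply/hitting_time_leP.
rewrite (_ : [set w | _] = set0)//.
by apply/seteqP; split=> w //= /hitting_time_leP[]; lra.
Qed.

End Process.

(** * Densities of extended real variables from their distribution functions *)

Lemma measurable_generated_by_lower_rays (R : realType) :
  (measurable : set (set (measurableTypeR R))) =
  <<s [set A : set R | exists x, A = `]-oo, x]%classic ] >>.
Proof.
rewrite (_ : measurable = (@ocitv R).-sigma.-measurable)//.
rewrite RGenOInfty.measurableE; apply/seteqP.
split; apply: smallest_sub; try exact: smallest_sigma_algebra.
  move=> _ [x ->]; rewrite -setCitvl.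
  by apply: sigma_algebraC; apply: sub_sigma_algebra; exists x.
move=> _ [x ->]; rewrite -setCitvr.
by apply: sigma_algebraC; apply: sub_sigma_algebra; exists x.
Qed.

(** Lower rays form a pi-system generating the Borel sets, and countably many of
    them cover the line. *)
Lemma finite_measure_unique_rays (R : realType)
    (m1 m2 : {measure set (measurableTypeR R) -> \bar R}) :
  (forall x, m1 `]-oo, x]%classic < +oo)%E ->
  (forall x, m1 `]-oo, x]%classic = m2 `]-oo, x]%classic) ->
  forall A, measurable A -> m1 A = m2 A.
Proof.
move=> fin1 m12 A mA.
apply: (@measure_unique _ R (measurableTypeR R)
  [set A : set R | exists x, A = `]-oo, x]%classic]
  (fun n => `]-oo, n%:R]%classic) _ _ _ _ m1 m2 _ _ A mA) => //.
- exact: measurable_generated_by_lower_rays.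
- move=> _ _ [x ->] [y ->]; exists (Num.min x y).
  by apply/seteqP; split=> z; rewrite /= !in_itv/= le_min => /andP.
- by move=> n; exists n%:R.
- apply/seteqP; split=> // x _; exists (Num.bound `|x|) => //=.
  by rewrite in_itv/= (le_trans (ler_norm x))// ltW// archi_boundP.
- by move=> _ [x ->].
Qed.

Section Density.
Context d (T : measurableType d) (R : realType) (P : probability T R).
Variable X : T -> \bar R.
Hypothesis X_ge0 : forall w, (0 <= X w)%E.
Hypothesis mX : forall t : R, measurable [set w | (X w <= t%:E)%E].

(** The real part of the distribution of X is carried by these events: X may
    equal +oo with positive probability, so that their total mass may be less
    than 1. *)
Definition finite_event (A : set R) : set T :=
  [set w | exists2 t, A t & X w = t%:E].

Lemma finite_eventE A : finite_event A = X @^-1` (EFin @` A).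
Proof. by apply/seteqP; split=> w /= [t At Xt]; exists t. Qed.

Lemma measurable_finite_event (A : set (measurableTypeR R)) :
  measurable A -> measurable (finite_event A).
Proof.
move=> mA; rewrite finite_eventE.
suff mfX : measurable_fun setT X.
  rewrite -[X in measurable X]setTI; apply: mfX => //.
  exact: measurable_image_EFin.
apply: (measurability _ (ErealGenOInfty.measurableE R)) => // _ [_ [x ->] <-].
rewrite setTI (_ : _ @^-1` _ = ~` [set w | (X w <= x%:E)%E]).
  exact: measurableC.
by apply/seteqP; split=> w /=; rewrite ?in_itv/= ?andbT ltNge => /negP.
Qed.

Lemma finite_event_rays (t : R) :
  finite_event `]-oo, t]%classic = [set w | (X w <= t%:E)%E].
Proof.
apply/seteqP; split=> w /=.
  by move=> [s /=]; rewrite in_itv/= => st ->; rewrite lee_fin.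
move=> Xt; have Xfin : X w \is a fin_num.
  by rewrite ge0_fin_numE// (le_lt_trans Xt) ?ltry.
exists (fine (X w)); last by rewrite fineK.
by rewrite /= in_itv/= -lee_fin fineK.
Qed.

Lemma finite_law_is_measure :
  exists m : {measure set (measurableTypeR R) -> \bar R},
    forall A, m A = P (finite_event A).
Proof.
pose law (A : set (measurableTypeR R)) : \bar R := P (finite_event A).
have law0 : law set0 = 0%E.
  by rewrite /law finite_eventE image_set0 preimage_set0 measure0.
have law_ge0 A : (0 <= law A)%E by exact: measure_ge0.
have law_sigma : semi_sigma_additive law.
  move=> F mF tF mUF; rewrite /law.
  have -> : finite_event (\bigcup_n F n) = \bigcup_n finite_event (F n).
    rewrite finite_eventE image_bigcup preimage_bigcup.
    by apply: eq_bigcupr => n _; rewrite finite_eventE.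
  apply: measure_sigma_additive.
  - by move=> n; exact: measurable_finite_event (mF n).
  - move=> i j _ _ [w [[t Ft Xt] [s Fs Xs]]]; apply: tF => //.
    by exists t; split=> //; move: Xs; rewrite Xt => -[->].
pose m : {measure set (measurableTypeR R) -> \bar R} := HB.pack law
  (isMeasure.Build _ _ _ law law0 law_ge0 law_sigma).
by exists m.
Qed.

Definition distribution_function (t : R) : R :=
  fine (P [set w | (X w <= t%:E)%E]).

Local Notation F := distribution_function.

Section FromCdf.
Variable q : R -> R.
Hypothesis q_continuous : forall t : R, 0 < t -> {for t, continuous q}.
Hypothesis q_cvg0 : q t @[t --> 0^'+] --> q 0.
Hypothesis F_derive : forall t : R, 0 < t -> is_derive t (1 : R) F (q t).
Hypothesis F_0 : F 0 = 0.
Hypothesis F_cvg0 : F t @[t --> 0^'+] --> F 0.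

Let F_homo : {homo F : s t / s <= t}.
Proof.
move=> s t st; rewrite fine_le ?fin_num_measure//.
apply: le_measure; rewrite ?inE// => w /= Xs.
by rewrite (le_trans Xs)// lee_fin.
Qed.

(** q is a limit of difference quotients of the non-decreasing F. *)
Let q_ge0 t : 0 < t -> 0 <= q t.
Proof.
move=> t0; have Ft := F_derive t0.
have <- : 'D_1 F t = q t by exact: derive_val.
apply: limr_ge; first exact: ex_derive.
near=> h; have h0 : h != 0 by near: h; exact: nbhs_dnbhs_neq.
rewrite scaler1 /GRing.scale/= /shift/=.
move: h0; rewrite neq_lt => /orP[] h0.
  by rewrite mulr_le0 ?invr_le0 ?(ltW h0)// subr_le0 F_homo// gerDr ltW.
by rewrite mulr_ge0 ?invr_ge0 ?(ltW h0)// subr_ge0 F_homo// lerDr ltW.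
Unshelve. all: by end_near. Qed.

Let q_measurable : measurable_fun (`]0, +oo[ : set R) q.
Proof.
apply: open_continuous_measurable_fun; first exact: interval_open.
by move=> t; rewrite inE/= in_itv/= andbT => /q_continuous.
Qed.

Let FTC t : 0 < t ->
  (\int[lebesgue_measure]_(x in `]0%R, t]) (q x)%:E)%E = (F t)%:E.
Proof.
move=> t0; rewrite integral_itv_obnd_cbnd; last first.
  apply/measurable_EFinP; apply: measurable_funS q_measurable => //.
  by apply: subset_itvl; rewrite bnd_simp.
have q_left : q x @[x --> t^'-] --> q t.
  by apply: cvg_at_left_filter; exact: q_continuous.
rewrite (@continuous_FTC2 _ q F)// ?F_0 ?sube0//.
- apply/continuous_within_itvP => //; split=> // x.
  by rewrite in_itv/= => /andP[x0 _]; exact: q_continuous.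
- split=> [x|//|].
    by rewrite in_itv/= => /andP[/F_derive Fx _]; exact: ex_derive.
  apply: cvg_at_left_filter; apply: differentiable_continuous.
  by apply/derivable1_diffP; have Ft := F_derive t0; exact: ex_derive.
- move=> x; rewrite in_itv/= => /andP[/F_derive Fx _].
  by rewrite derive1E; exact: derive_val.
Qed.

Let density_is_measure :
  exists m : {measure set (measurableTypeR R) -> \bar R}, forall A,
    m A = (\int[lebesgue_measure]_(x in A `&` `]0%R, +oo[) (q x)%:E)%E.
Proof.
pose g : R -> \bar R := (EFin \o q) \_ `]0, +oo[%classic.
have mg : measurable_fun setT g.
  by apply/measurable_restrict => //; rewrite setTI; exact/measurable_EFinP.
have g_ge0 x : (0 <= g x)%E.
  rewrite /g patchE; case: ifPn => //; rewrite inE/= in_itv/= andbT => x0.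
  by rewrite lee_fin q_ge0.
pose law (A : set (measurableTypeR R)) : \bar R :=
  (\int[lebesgue_measure]_(x in A) g x)%E.
have law0 : law set0 = 0%E by exact: integral_set0.
have law_ge0 A : (0 <= law A)%E by exact: integral_ge0.
have law_sigma : semi_sigma_additive law.
  exact: semi_sigma_additive_nng_induced.
pose m : {measure set (measurableTypeR R) -> \bar R} := HB.pack law
  (isMeasure.Build _ _ _ law law0 law_ge0 law_sigma).
by exists m => A; rewrite integral_mkcondr.
Qed.

(** The law of X on the reals and the measure with density q agree on the lower
    rays: on those ending at t > 0 by the fundamental theorem of calculus on the
    closed interval [0, t], hence the conditions at the endpoint 0, and on the
    others because the non-decreasing F vanishes at 0. *)
Lemma is_density_of_cdf : is_density P X q.
Proof.
split=> // A mA; have [m1 m1E] := finite_law_is_measure.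
have [m2 m2E] := density_is_measure.
rewrite -m2E -[LHS]m1E; apply: finite_measure_unique_rays mA.
  move=> t; rewrite m1E finite_event_rays.
  by rewrite (le_lt_trans (probability_le1 _ _)) ?ltry.
move=> t; rewrite m1E finite_event_rays m2E -[LHS]fineK ?fin_num_measure//.
rewrite -/(F t); have [t0|t0] := leP t 0.
  rewrite (_ : _ `&` _ = set0) ?integral_set0.
    congr EFin; apply/eqP; rewrite eq_le -[X in _ <= X]F_0 F_homo//=.
    exact: fine_ge0.
  apply/seteqP; split=> // x [] /=; rewrite !in_itv/= andbT => xt x0.
  by have := lt_le_trans x0 (le_trans xt t0); rewrite ltxx.
rewrite -FTC//; congr integral.
apply/seteqP; split=> x /=; rewrite !in_itv/= ?andbT.
  by move=> /andP[-> ->].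
by move=> [-> ->].
Qed.

End FromCdf.

End Density.

(** * The density of the hitting times *)

Section HittingDensity.
Context d (T : measurableType d) (R : realType) (P : probability T R).
Context (lambda : R) (nu : {measure set (measurableTypeR R) -> \bar R}).
Variable N : R -> {RV P >-> nat}.
Hypotheses (lambda_gt0 : 0 < lambda) (nu_levy : levy_condition nu).
Hypothesis N_gpp : generalized_poisson_process lambda nu N.

Local Notation u := (survival N).
Local Notation c := (jump_rate lambda nu).
Local Notation rate := (convolution_rate u c).

Let u01 k (t : R) : 0 <= t -> 0 <= u k t <= 1.
Proof. by move=> _; exact: survival_ge0_le1. Qed.

Let u_convolution k (t h : R) : 0 <= t -> 0 <= h ->
  u k (t + h) = \sum_(m < k) increment_prob N 0 h m * u (k - m)%N t.
Proof. by move=> t0 h0; exact: (survival_convolution N_gpp). Qed.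

Let p_rate m (eps : R) : 0 < eps -> \forall h \near 0^'+,
  `|increment_prob N 0 h m - (m == 0%N)%:R - h * c m| <= eps * h.
Proof.
by move=> eps0; exact: (increment_prob_rate N_gpp m lambda_gt0 nu_levy eps0).
Qed.

Lemma hitting_cdf_is_derive k (t : R) : 0 < t ->
  is_derive t (1 : R) (hitting_cdf N k) (- rate k t).
Proof.
move=> t0; apply: (@near_eq_is_derive _ _ _ (cst 1 - u k)).
  by apply: near_gt0_eq => // x x0; rewrite (hitting_cdfE N_gpp)// ltW.
have du := convolution_is_derive u01 u_convolution p_rate k t0.
by apply: is_derive_eq; rewrite sub0r.
Qed.

Lemma hitting_densityE (k : nat) (t : R) : (0 < k)%N -> 0 < t ->
  hitting_density N k t = - rate k t.
Proof.
case: k => // k _ t0; rewrite /hitting_density derive1E.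
have dF := hitting_cdf_is_derive k.+1 t0.
exact: derive_val.
Qed.

(** By hitting_densityE the density is a constant-coefficient combination of the
    tails, whose derivatives are minus the densities. *)
Lemma hitting_density_is_derive (k : nat) (t : R) : (0 < k)%N -> 0 < t ->
  is_derive t (1 : R) (hitting_density N k)
    (\sum_(m < k) c m * hitting_density N (k - m)%N t).
Proof.
move=> k0 t0.
apply: (@near_eq_is_derive _ _ _ (\sum_(m < k) (- c m \*: u (k - m)%N))).
  apply: near_gt0_eq => // x x0; rewrite hitting_densityE// fct_sumE.
  rewrite /convolution_rate -sumrN.
  by apply: eq_bigr => m _; exact: mulNr.
apply: is_derive_eq.
  apply: is_derive_sum => m; apply: is_deriveZ.
  exact: convolution_is_derive u01 u_convolution p_rate (k - m)%N t t0.
apply: eq_bigr => m _.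
by rewrite hitting_densityE ?subn_gt0// /GRing.scale/= mulNr mulrN.
Qed.

Lemma hitting_time_density (k : nat) : (0 < k)%N ->
  is_density P (hitting_time N k) (hitting_density N k).
Proof.
move=> k0.
have u0 : u k 0 = 1.
  rewrite /survival (_ : [set w | _] = setT) ?probability_setT//.
  by apply/seteqP; split=> // w _ /=; rewrite (gpp_start N_gpp).
have cdf0 : hitting_cdf N k 0 = 0 by rewrite (hitting_cdfE N_gpp)// u0 subrr.
have u_right j : u j x @[x --> 0^'+] --> u j 0.
  exact: convolution_cvg_right0 u01 u_convolution p_rate j.
have [rate_ge0 rate_meas rate_law] :
    is_density P (hitting_time N k) (fun t => - rate k t).
  apply: is_density_of_cdf.
  - exact: hitting_time_ge0.
  - exact: measurable_hitting_time_le N_gpp k.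
  - move=> t t0; apply: cvgN; apply: convolution_rate_cvg => j.
    exact: convolution_continuous u01 u_convolution p_rate j t t0.
  - by apply: cvgN; apply: convolution_rate_cvg.
  - by move=> t t0; exact: hitting_cdf_is_derive.
  - exact: cdf0.
  - rewrite [X in _ --> X]cdf0.
    have : 1 - u k x @[x --> 0^'+] --> 1 - u k 0.
      by apply: cvgB; [exact: cvg_cst|exact: u_right].
    rewrite u0 subrr; apply: cvg_trans; apply: near_eq_cvg.
    near=> x; have x0 : 0 < x by near: x; exact: nbhs_right_gt.
    by rewrite [RHS](hitting_cdfE N_gpp)// ltW.
have rateE x : x \in `]0, +oo[%classic -> - rate k x = hitting_density N k x.
  move=> /set_mem x0; rewrite hitting_densityE//.
  by move: x0; rewrite /= in_itv/= andbT.
split.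
- by move=> t t0; rewrite hitting_densityE// rate_ge0.
- exact: eq_measurable_fun rate_meas.
- move=> A mA; rewrite rate_law//; apply: eq_integral => x.
  by rewrite inE => -[_ x0]; rewrite rateE// inE.
Unshelve. all: by end_near. Qed.

End HittingDensity.

Theorem theorem3p2 (R : realType) (lambda : R)
    (nu : {measure set (measurableTypeR R) -> \bar R})
    (d : measure_display) (T : measurableType d) (P : probability T R)
    (N : R -> {RV P >-> nat}) :
  0 < lambda -> levy_condition nu ->
  generalized_poisson_process lambda nu N ->
  forall k : nat, (1 <= k)%N ->
    [/\ forall t : R, 0 < t -> derivable (hitting_cdf N k) t 1,
        is_density P (hitting_time N k) (hitting_density N k%:Z)
      & forall t : R, 0 < t ->
          derivable (hitting_density N k%:Z) t 1 /\
          bernstein_shift_op lambda nu (hitting_density N) k%:Z t =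
            - derive1 (hitting_density N k%:Z) t].
Proof.
move=> lambda_gt0 nu_levy N_gpp k k0; split.
- move=> t t0.
  have dF := hitting_cdf_is_derive lambda_gt0 nu_levy N_gpp k t0.
  exact: ex_derive.
- exact: hitting_time_density lambda_gt0 nu_levy N_gpp k k0.
- move=> t t0.
  have dq := hitting_density_is_derive lambda_gt0 nu_levy N_gpp k0 t0.
  split; first exact: ex_derive.
  rewrite bernstein_shift_opE//; last by case=> [[|j]|j].
  by rewrite derive1E; congr (- _); apply/esym; exact: derive_val.
Qed.
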